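(* Let $\mathcal I=\{\mu,\nu,\rho,\omega\}$ where $\mu\#\omega$ and $\mu\#\rho$. Assume $c_\mu\le c_\rho+c_\omega\le c_\mu+c_\nu$, and let the state $q\in\mathbb{Z}_+^{\mathcal I}$ be such that $q_\nu=0$ and $q_\mu,q_\rho,q_\omega\ge 1$. Then in any value iteration the optimal action at $q$ is to serve packets in queues $\rho$ and $\omega$; that is, for every $n\ge 0$ the schedule $e_\rho+e_\omega$ attains the maximum $$\max_{s\in\mathcal P}\left\{ r(q,s)+\beta\,\mathbb{E}\big[V_n((q-s)^++A)\big]\right\}.$$
   Context: Let $\mathcal I=\{(i,j): i,j\in\{1,2\}\}$ index the four queues of a $2\times 2$ input-queued switch (queue $(i,j)$ is for input port $i$ and output port $j$). States are vectors $q=(q_\rho)_{\rho\in\mathcal I}\in\mathbb{Z}_+^{\mathcal I}\cong\mathbb{Z}_+^4$, $\mathbb{Z}_+=\{0,1,2,\dots\}$. A schedule is a vector $s=(s_\rho)_{\rho\in\mathcal I}\in\{0,1\}^{\mathcal I}$ with $\sum_j s_{(i,j)}\le 1$ for each $i$ and $\sum_i s_{(i,j)}\le 1$ for each $j$; $\mathcal P$ is the set of all schedules. The arrival vector $A=(A_\rho)_{\rho\in\mathcal I}$ takes values in $\mathbb{Z}_+^{\mathcal I}$, has independent coordinates, and its means $\lambda_\rho=\mathbb{E}[A_\rho]$ satisfy $\sum_i\lambda_{(i,j)}<1$ for each $j$ and $\sum_j\lambda_{(i,j)}<1$ for each $i$. Fix cost constants $c_\rho\ge 0$ ($\rho\in\mathcal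 I$) and $\beta\in(0,1)$. The reward is $r(q,s)=\sum_{\rho\in\mathcal I}c_\rho s_\rho\,\mathbb{I}_{\{q_\rho>0\}}$. Write $(x)^+$ for the componentwise maximum of $x$ and $0$. The value functions of value iteration are $V_0\equiv 0$ and $V_{n+1}(q)=\max_{s\in\mathcal P}\{r(q,s)+\beta\,\mathbb{E}[V_n((q-s)^++A)]\}$ for $n\ge 0$. $e_\rho$ denotes the unit vector of $\mathbb{Z}_+^{\mathcal I}$ with a single $1$ in coordinate $\rho$. For two distinct queues, $\mu\#\rho$ means that $\mu$ and $\rho$ cannot both be contained in a schedule (they share an input or an output port), e.g. $(1,1)\#(1,2)$ and $(2,2)\#(2,1)$. *)

(* Defs.v *)
From HB Require Import structures.
From mathcomp Require Import all_boot all_order all_algebra.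
From mathcomp Require Import all_classical all_reals all_analysis.

Set Implicit Arguments.
Unset Strict Implicit.
Unset Printing Implicit Defensive.

Import Order.TTheory GRing.Theory Num.Theory.

Local Open Scope ring_scope.

(* (i, j) is the queue of input port i and output port j; the ports 1, 2 are
   encoded as the ordinals 0, 1. *)
Definition queue : finType := ('I_2 * 'I_2)%type.

Definition state := {ffun queue -> nat}.

(* 0/1-vectors; [schedules] below selects the admissible ones. *)
Definition action := {ffun queue -> bool}.

Definition schedules : {set action} :=
  [set s : action |
     [forall i : 'I_2, (\sum_(j < 2) s (i, j) <= 1)%N] &&
     [forall j : 'I_2, (\sum_(i < 2) s (i, j) <= 1)%N]].

(* \sum_(x in D) e_x; for rho != omega, [serve [set rho; omega]] is
   e_rho + e_omega. *)
Definition serve (D : {set queue}) : action := [ffun x => x \in D].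

Definition conflict (x y : queue) : bool :=
  (x != y) && ~~ [exists s in schedules, s x && s y].

Lemma conflictE (x y : queue) :
  conflict x y = (x != y) && ((x.1 == y.1) || (x.2 == y.2)).
Proof.
rewrite /conflict; have [//|nxy /=] := eqVneq x y.
apply/idP/idP.
  apply: contraR; rewrite negb_or => /andP[n1 n2].
  apply/existsP; exists (serve [set x; y]%SET).
  rewrite !ffunE !inE !eqxx orbT !andbT.
  case: x y n1 n2 {nxy} => [x1 x2] [y1 y2] /= n1 n2.
  apply/andP; split; apply/forallP => i.
  - rewrite !big_ord_recl big_ord0 !ffunE !inE !xpair_eqE.
    move: n1 n2.
    by case: x1 => [[|[|]]//] ?; case: x2 => [[|[|]]//] ?;
       case: y1 => [[|[|]]//] ?; case: y2 => [[|[|]]//] ?;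
       case: i => [[|[|]]//] ?.
  - rewrite !big_ord_recl big_ord0 !ffunE !inE !xpair_eqE.
    move: n1 n2.
    by case: x1 => [[|[|]]//] ?; case: x2 => [[|[|]]//] ?;
       case: y1 => [[|[|]]//] ?; case: y2 => [[|[|]]//] ?;
       case: i => [[|[|]]//] ?.
move=> same; apply/existsP => -[s /andP[]].
rewrite inE => /andP[/forallP row /forallP col] /andP[sx sy].
case: x y nxy same sx sy => [x1 x2] [y1 y2] /= nxy.
rewrite xpair_eqE negb_and in nxy.
case/orP => /eqP e; subst; rewrite eqxx ?orbF /= in nxy => sx sy.
  by have := row y1; rewrite (bigD1 x2)//= (bigD1 y2) ?sx ?sy//= eq_sym.
by have := col y2; rewrite (bigD1 x1)//= (bigD1 y1) ?sx ?sy//= eq_sym.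
Qed.

(* (q - s)^+ + a : subtraction on nat is truncated, which gives the positive
   part. *)
Definition next_state (q : state) (s : action) (a : queue -> nat) : state :=
  [ffun x => (q x - s x + a x)%N].

Section ValueIteration.
Context {d : measure_display} {T : measurableType d} {R : realType}.
Variables (P : probability T R) (A : queue -> {RV P >-> nat}).
Variables (c : queue -> R) (beta : R).

(* Every subset of nat is measurable. *)
Definition independent_coordinates : Prop :=
  forall (J : {set queue}) (B : queue -> set nat),
    P (\bigcap_(x in [set` J]) (A x @^-1` B x))%classic =
    (\prod_(x in J) P (A x @^-1` B x)%classic)%E.

Definition mean (x : queue) : \bar R := ('E_P[fun t => (A x t)%:R])%E.

Definition reward (q : state) (s : action) : R :=
  \sum_(x : queue) c x * (s x)%:R * (0 < q x)%N%:R.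

(* The iterates V below are bounded functions of the state, so the expectation
   is finite and [fine] only removes the injection into \bar R. *)
Definition action_value (V : state -> R) (q : state) (s : action) : R :=
  reward q s +
  beta * fine ('E_P[fun t => V (next_state q s (fun x => A x t))])%E.

(* The maximum over all schedules: the base value of the iterated max is the
   value of the idle schedule, which is itself in [schedules]. *)
Definition max_value (V : state -> R) (q : state) : R :=
  \big[Num.max/action_value V q (serve finset.set0)]_(s in schedules)
    action_value V q s.

Fixpoint value (n : nat) : state -> R :=
  if n is m.+1 then max_value (value m) else fun=> 0.

Definition optimal_action (n : nat) (q : state) (s : action) : Prop :=
  s \in schedules /\ action_value (value n) q s = max_value (value n) q.

End ValueIteration.

(* Main.v *)
Require Import Defs.
From HB Require Import structures.
From mathcomp Require Import all_boot all_order all_algebra.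
From mathcomp Require Import all_classical all_reals all_analysis.
From mathcomp Require Import zify lra.
Import Order.TTheory GRing.Theory Num.Theory.
Local Open Scope ring_scope.

(** Write M1 = {mu, nu} and M2 = {rho, omega} for the two perfect matchings of
    the switch. Every schedule is contained in one of them, and serving more
    queues never hurts, so only M1 and M2 compete. At q the reward of M2 exceeds
    that of M1 by D = c rho + c omega - c mu >= 0, because nu is empty. The
    state after M1 differs from the state after M2 in that it lacks a packet in
    mu and has one packet more in each of rho and omega. So M2 is optimal as
    soon as, for every value iterate V and every state u,
      V (u + e_rho + e_omega) <= V (u + e_mu) + D,
    since this advantage is discounted by beta <= 1 and D >= 0
    ([exchange_bounded_value]).

    The exchange inequality follows by induction on the horizon, by letting the
    system in u + e_mu answer every action of the other one with M1:
    - against M2, the next states differ by at most one packet in nu, and the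
      reward for that packet has just been collected;
    - against M1 with mu nonempty in u, the rewards agree and the next states
      are again in the exchange relation;
    - against M1 with mu empty in u, the reward for mu is gained, and the next
      states differ by one packet in each of rho and omega.

    Both the domination by maximal schedules and the first and third cases rest
    on one estimate: an additional packet in queue x is worth at most c x
    ([excess_bounded_value]). In all comparisons the same arrivals are used in
    both systems, so only monotonicity of the expectation is needed; for this
    the value iterates must be integrable functions of the arrivals, which
    holds because they are bounded and the state space is countable. *)

(** * Schedules of the switch *)

Lemma next_stateE (q : state) (s : action) (a : queue -> nat) (x : queue) :
  next_state q s a x = (q x - s x + a x)%N.
Proof. exact: ffunE. Qed.

Lemma schedule_subset (s s' : action) :
  (forall x, s' x -> s x) -> s \in schedules -> s' \in schedules.
Proof.
move=> s's; have le x : (s' x <= s x)%N.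
  by move: (s' x) (s x) (s's x) => [] [] //= /(_ isT).
rewrite !inE => /andP[/forallP row /forallP col].
apply/andP; split; apply/forallP => i.
  by apply: leq_trans (row i); apply: leq_sum => j _; exact: le.
by apply: leq_trans (col i); apply: leq_sum => j _; exact: le.
Qed.

Lemma idle_schedule : serve finset.set0 \in schedules.
Proof.
rewrite inE; apply/andP; split; apply/forallP => i;
  by rewrite big1// => j _; rewrite ffunE inE.
Qed.

Lemma pair_schedule (x y : queue) :
  x != y -> ~~ conflict x y -> serve [set x; y]%SET \in schedules.
Proof.
move=> xy; rewrite /conflict xy /= negbK => /existsP[s /and3P[sS sx sy]].
apply: schedule_subset sS => z; rewrite ffunE !inE.
by case/orP => /eqP ->.
Qed.

Section TwoMatchings.
Context {mu nu rho omega : queue}.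
Hypotheses (queuesE : [set mu; nu; rho; omega]%SET = [set: queue]%SET)
  (mu_omega : conflict mu omega) (mu_rho : conflict mu rho).

Lemma queues_uniq : uniq [:: mu; nu; rho; omega].
Proof.
apply/card_uniqP; transitivity #|[set: queue]%SET|.
  by rewrite -queuesE; apply: eq_card => x; rewrite !inE !orbA.
by rewrite cardsT card_prod card_ord.
Qed.

Lemma queues_neq : [&& mu != nu, mu != rho, mu != omega, nu != rho,
  nu != omega & rho != omega].
Proof.
by move: queues_uniq; rewrite /= !inE !negb_or andbT -!andbA.
Qed.

Lemma sum_queues {V : nmodType} (F : queue -> V) :
  \sum_x F x = F mu + F nu + F rho + F omega.
Proof.
transitivity (\sum_(x <- [:: mu; nu; rho; omega]) F x).
  apply: perm_big; apply: uniq_perm; rewrite ?index_enum_uniq ?queues_uniq//.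
  move=> x; rewrite mem_index_enum.
  by have := finset.in_setT x; rewrite -queuesE !inE !orbA => ->.
by rewrite !big_cons big_nil addr0 !addrA.
Qed.

(** Both rho and omega share exactly one port with mu, hence lie in the two
    positions next to mu in the 2 x 2 array, and nu is diagonally opposite. *)
Lemma conflict_pattern : [&& conflict nu omega, conflict nu rho,
  ~~ conflict mu nu & ~~ conflict rho omega].
Proof.
move: mu_omega mu_rho queues_uniq; rewrite !conflictE /= !inE !negb_or.
case: mu nu rho omega => [m1 m2] [n1 n2] [r1 r2] [w1 w2] /=.
rewrite !xpair_eqE.
by move: m1 m2 n1 n2 r1 r2 w1 w2; do 8![case=> [[|[|]]//] ?].
Qed.

(** The conflict graph is the 4-cycle mu, rho, nu, omega, whose maximal
    independent sets are the two diagonals. *)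
Lemma schedule_sub_matching (s : action) : s \in schedules ->
  (forall x, s x -> serve [set mu; nu]%SET x) \/
  (forall x, s x -> serve [set rho; omega]%SET x).
Proof.
move=> sS.
have excl x y : conflict x y -> s x -> s y = false.
  move=> /andP[_ /existsPn/(_ s)]; rewrite sS /= => /nandP[/negbTE -> //|].
  by move=> /negbTE.
have /and4P[nu_omega nu_rho _ _] := conflict_pattern.
have four x : [|| x == mu, x == nu, x == rho | x == omega].
  by have := finset.in_setT x; rewrite -queuesE !inE -!orbA.
case smn : (s mu || s nu); [left|right] => x sx; rewrite ffunE !inE;
  case/or4P: (four x) sx => /eqP ->; rewrite ?eqxx ?orbT//.
- by case/orP: smn => [/(excl _ _ mu_rho)|/(excl _ _ nu_rho)] ->.
- by case/orP: smn => [/(excl _ _ mu_omega)|/(excl _ _ nu_omega)] ->.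
- by move=> smu; rewrite smu in smn.
- by move=> snu; rewrite snu orbT in smn.
Qed.

Lemma serve_matchingsE (S1 := serve [set mu; nu]%SET)
    (S2 := serve [set rho; omega]%SET) :
  ((S1 mu = true) * (S1 nu = true) * (S1 rho = false) * (S1 omega = false)) *
  ((S2 mu = false) * (S2 nu = false) * (S2 rho = true) * (S2 omega = true)).
Proof.
have /and5P[mn mr mo nr /andP[no ro]] := queues_neq.
by do !split; rewrite ffunE !inE ?eqxx ?orbT//;
  apply/norP; split; rewrite // eq_sym.
Qed.

End TwoMatchings.

(** * Expectations over the arrivals *)

Section Expectation.
Context {d : measure_display} {T : measurableType d} {R : realType}.
Context {P : probability T R} (A : queue -> {RV P >-> nat}).

Definition bounded_on_states (V : state -> R) : Prop :=
  exists M, forall q, `|V q| <= M.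

(** The state space is countable, so the preimage of any set is a countable
    union of events fixing the arrivals at all four queues. *)
Lemma measurable_comp_next_state (V : state -> R) (q : state) (s : action) :
  measurable_fun setT (fun t => V (next_state q s (fun x => A x t))).
Proof.
move=> _ Y mY; rewrite setTI.
pose S : set state := (fun a : state => Y (V (next_state q s a))).
have -> : ((fun t => V (next_state q s (fun x => A x t))) @^-1` Y =
   \bigcup_(a in S) \bigcap_(x in setT) (A x @^-1` [set a x]))%classic.
  apply/seteqP; split => t /=.
    move=> Yt; exists [ffun x => A x t]; last by move=> x _ /=; rewrite ffunE.
    rewrite /S /=; congr (Y (V _)): Yt.
    by apply/ffunP => x; rewrite !ffunE.
  case=> a Sa Aa; congr (Y (V _)): Sa.
  by apply/ffunP => x; rewrite !ffunE (Aa x I).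
rewrite bigcup_mkcond; apply: countable_bigcupT_measurable => [|a].
  exact: countableP.
case: ifP => // _; apply: fin_bigcap_measurable => // x _.
by rewrite -[X in measurable X]setTI; exact: measurable_funP.
Qed.

Lemma integrable_comp_next_state (V : state -> R) (q : state) (s : action) :
  bounded_on_states V ->
  P.-integrable setT (EFin \o (fun t => V (next_state q s (fun x => A x t)))).
Proof.
move=> [M VM]; apply: measurable_bounded_integrable => //.
- exact: fin_num_fun_lty (fin_num_measure P).
- exact: measurable_comp_next_state.
- exists M; split; first exact: num_real.
  by move=> N /ltW MN t _ /=; exact: le_trans (VM _) MN.
Qed.

(** Coupling: two systems fed with the same arrivals can be compared arrival
    by arrival. *)
Lemma expectation_next_state_le (V W : state -> R) (q q' : state)
    (s s' : action) (K : R) :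
    bounded_on_states V -> bounded_on_states W ->
    (forall a, V (next_state q s a) <= W (next_state q' s' a) + K) ->
  fine 'E_P[fun t => V (next_state q s (fun x => A x t))] <=
  fine 'E_P[fun t => W (next_state q' s' (fun x => A x t))] + K.
Proof.
move=> Vb Wb VW; rewrite unlock.
have iK : P.-integrable setT (EFin \o cst K).
  exact: finite_measure_integrable_cst.
have iV := integrable_comp_next_state V q s Vb.
have iW := integrable_comp_next_state W q' s' Wb.
have -> : K = (\int[P]_(x in setT) K)%R.
  rewrite Rintegral_cst// -[LHS]mulr1; congr (_ * _).
  exact/esym/(congr1 fine (probability_setT P)).
rewrite -[leRHS](RintegralD measurableT iW iK).
apply: le_Rintegral => //.
exact: (integrableD measurableT iW iK).
Qed.

(** The coupling inequality against the zero function, in both directions. *)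
Lemma expectation_next_state_bound (V : state -> R) (q : state) (s : action)
    (M : R) : (forall p, `|V p| <= M) ->
  `|fine 'E_P[fun t => V (next_state q s (fun x => A x t))]| <= M.
Proof.
move=> VM; have Vb : bounded_on_states V by exists M.
pose Z : state -> R := fun=> 0.
have Zb : bounded_on_states Z by exists 0 => p; rewrite normr0.
have EZ : fine 'E_P[fun t => Z (next_state q s (fun x => A x t))] = 0.
  by rewrite unlock /= integral0_eq.
rewrite ler_norml; apply/andP; split.
  rewrite -subr_ge0 opprK -EZ; apply: expectation_next_state_le => // a.
  by have := VM (next_state q s a); rewrite ler_norml /Z => /andP[? _]; lra.
rewrite -[leRHS]add0r -EZ; apply: expectation_next_state_le => // a.
by have := VM (next_state q s a); rewrite ler_norml /Z add0r => /andP[].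
Qed.

End Expectation.

(** * The Bellman operator *)

Section Bellman.
Context {d : measure_display} {T : measurableType d} {R : realType}.
Context {P : probability T R} (A : queue -> {RV P >-> nat}).
Context (c : queue -> R) (beta : R).
Hypotheses (c_ge0 : forall x, 0 <= c x) (beta_ge0 : 0 <= beta)
  (beta_le1 : beta <= 1).

Notation action_value := (action_value A c beta).
Notation max_value := (max_value A c beta).
Notation value := (value A c beta).

(** The comparison used at each induction step: a uniform bound K on the
    difference of the continuation values enters discounted. *)
Lemma action_value_le (V : state -> R) (q q' : state) (s s' : action)
    (K L : R) :
    bounded_on_states V ->
    (forall a, V (next_state q s a) <= V (next_state q' s' a) + K) ->
    reward c q s + beta * K <= reward c q' s' + L ->
  action_value V q s <= action_value V q' s' + L.
Proof.
move=> Vb VK rKL; rewrite /Defs.action_value.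
have := expectation_next_state_le A V V q q' s s' K Vb Vb VK.
move=> /(ler_wpM2l beta_ge0).
by rewrite mulrDr; lra.
Qed.

Lemma max_value_ge (V : state -> R) (q : state) (s : action) :
  s \in schedules -> action_value V q s <= max_value V q.
Proof. by move=> sS; exact: le_bigmax_cond. Qed.

Lemma max_value_le (V : state -> R) (q : state) (K : R) :
  (forall s, s \in schedules -> action_value V q s <= K) ->
  max_value V q <= K.
Proof.
move=> VK; apply/bigmax_leP; split => //; exact/VK/idle_schedule.
Qed.

Lemma reward_bound (q : state) (s : action) :
  0 <= reward c q s <= \sum_x c x.
Proof.
apply/andP; split.
  by apply: sumr_ge0 => x _; rewrite !mulr_ge0.
apply: ler_sum => x _; rewrite -mulrA ler_piMr//.
by case: (s x) (0 < q x)%N => [] []; rewrite ?mulr0 ?mulr1 ?mul0r ?ler01.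
Qed.

Lemma bounded_value (n : nat) : bounded_on_states (value n).
Proof.
elim: n => [|n IH]; first by exists 0 => q /=; rewrite normr0.
have [M VM] := IH.
have aM q s : `|action_value (value n) q s| <= \sum_x c x + beta * M.
  rewrite /Defs.action_value (le_trans (ler_normD _ _))// lerD//.
    by have /andP[r0 rC] := reward_bound q s; rewrite ger0_norm.
  rewrite normrM (ger0_norm beta_ge0) ler_wpM2l//.
  exact: expectation_next_state_bound.
exists (\sum_x c x + beta * M) => q; rewrite ler_norml; apply/andP; split.
  apply: le_trans (max_value_ge _ q _ idle_schedule).
  by have := aM q (serve finset.set0); rewrite ler_norml => /andP[].
by apply: max_value_le => s _; have := aM q s; rewrite ler_norml => /andP[].
Qed.

Lemma reward_pair (p : state) (x y : queue) : x != y ->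
  reward c p (serve [set x; y]%SET) = c x * (0 < p x)%:R + c y * (0 < p y)%:R.
Proof.
move=> xy; rewrite /reward (bigD1 x)//= (bigD1 y) 1?eq_sym//= big1 => [|z].
  by rewrite !ffunE !inE !eqxx orbT !mulr1 addr0.
by case/andP => zx zy; rewrite ffunE !inE (negbTE zx) (negbTE zy) mulr0 mul0r.
Qed.

Definition excess_cost (p q : state) : R := \sum_x c x * (p x - q x)%:R.

Definition excess_bounded (V : state -> R) : Prop :=
  forall p q, V p <= V q + excess_cost p q.

(** Both systems take the same action. For each queue x, the
    discrepancy (p x - q x)^+ decreases by one exactly when that action collects
    c x in p but finds x empty in q, and otherwise it does not grow. The
    truncated difference makes this one estimate cover both the monotonicity of
    the value and the worth of extra packets. *)
Lemma excess_bounded_value (n : nat) : excess_bounded (value n).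
Proof.
elim: n => [|n IH] p q /=.
  by rewrite add0r; apply: sumr_ge0 => x _; rewrite mulr_ge0.
apply: max_value_le => s sS.
apply: (@le_trans _ _ (action_value (value n) q s + excess_cost p q));
  last first.
  by rewrite lerD2r; exact: max_value_ge.
pose next_excess : R := \sum_x c x * (p x - s x - (q x - s x))%:R.
apply: (action_value_le _ _ _ _ _ next_excess); first exact: bounded_value.
  move=> a; apply: le_trans (IH _ (next_state q s a)) _; rewrite lerD2l.
  apply: ler_sum => x _.
  by rewrite !ffunE subnDr.
apply: (@le_trans _ _ (reward c p s + next_excess)).
  rewrite lerD2l ler_piMl//.
  by apply: sumr_ge0 => x _; rewrite mulr_ge0.
rewrite -!big_split /=; apply: ler_sum => x _.
rewrite -!mulrA -!mulrDr ler_wpM2l// -!natrM -!natrD ler_nat.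
by case: (s x); lia.
Qed.

(** A packet left waiting is worth at most its cost, and only after
    discounting, so it is better to serve it now. *)
Lemma action_value_subset (V : state -> R) (q : state) (s s' : action) :
    bounded_on_states V -> excess_bounded V -> (forall x, s x -> s' x) ->
  action_value V q s <= action_value V q s'.
Proof.
move=> Vb Ve ss'; rewrite -[leRHS]addr0.
pose next_excess : R := \sum_x c x * (q x - s x - (q x - s' x))%:R.
apply: (action_value_le _ _ _ _ _ next_excess) => //.
  move=> a; apply: le_trans (Ve _ (next_state q s' a)) _; rewrite lerD2l.
  apply: ler_sum => x _.
  by rewrite !ffunE subnDr.
rewrite addr0; apply: (@le_trans _ _ (reward c q s + next_excess)).
  rewrite lerD2l ler_piMl//.
  by apply: sumr_ge0 => x _; rewrite mulr_ge0.
rewrite -!big_split /=; apply: ler_sum => x _.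
rewrite -!mulrA -!mulrDr ler_wpM2l// -!natrM -!natrD ler_nat.
by move: (s x) (s' x) (q x) (ss' x) => [] [] k h; lia.
Qed.

(** * The exchange inequality *)

Section Exchange.
Context (mu nu rho omega : queue).
Hypotheses (queuesE : [set mu; nu; rho; omega]%SET = [set: queue]%SET)
  (mu_omega : conflict mu omega) (mu_rho : conflict mu rho)
  (c_lb : c mu <= c rho + c omega).

(** The two states are p = u + e_rho + e_omega and p' = u + e_mu for a common
    state u. *)
Definition exchange_bounded (V : state -> R) : Prop :=
  forall p p' : state, p' mu = (p mu).+1 -> p' nu = p nu ->
    p rho = (p' rho).+1 -> p omega = (p' omega).+1 ->
    V p <= V p' + (c rho + c omega - c mu).

Lemma exchange_bounded_value (n : nat) : exchange_bounded (value n).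
Proof.
have /and5P[mn _ _ _ /andP[_ ro]] := queues_neq queuesE.
have /and4P[_ _ Nmn Nro] := conflict_pattern queuesE mu_omega mu_rho.
elim: n => [|n IH] p p' Emu Enu Erho Eomega /=; first by rewrite add0r subr_ge0.
have Vb := bounded_value n.
have Ve := excess_bounded_value n.
have SE := serve_matchingsE queuesE.
set S1 := serve [set mu; nu]%SET in SE *.
set S2 := serve [set rho; omega]%SET in SE *.
have S1S : S1 \in schedules by exact: pair_schedule.
have D0 : 0 <= c rho + c omega - c mu by rewrite subr_ge0.
apply: max_value_le => s sS.
apply: (@le_trans _ _
  (action_value (value n) p' S1 + (c rho + c omega - c mu))); last first.
  by rewrite lerD2r; exact: max_value_ge.
have [sS1|sS2] :=
  schedule_sub_matching queuesE mu_omega mu_rho s sS.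
  apply: le_trans (action_value_subset _ _ _ _ Vb Ve sS1) _.
  (* M1 is available on both sides; it can be idle in mu only on the left. *)
  have [pmu0|pmu_gt0] := posnP (p mu).
    (* The packet of mu on the right is gone, the two others are left over. *)
    apply: (action_value_le _ _ _ _ _ (c rho + c omega)) => //.
      move=> a; apply: le_trans (Ve _ (next_state p' S1 a)) _.
      rewrite lerD2l /excess_cost (sum_queues queuesE) !next_stateE !SE.
      rewrite Emu Enu Erho Eomega pmu0 !subnDr !subn0 !sub0n !subnn !subSnn.
      by rewrite !mulr0 !mulr1 !add0r.
    rewrite !reward_pair// Emu Enu pmu0 ltnn ltn0Sn mulr0 mulr1 add0r.
    have : beta * (c rho + c omega) <= c rho + c omega.
      by rewrite ler_piMl// addr_ge0.
    by lra.
  apply: (action_value_le _ _ _ _ _ (c rho + c omega - c mu)) => //.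
    move=> a; apply: IH; rewrite !next_stateE !SE ?subn0.
    - by rewrite Emu !subn1 -addSn prednK.
    - by rewrite Enu.
    - by rewrite Erho addSn.
    - by rewrite Eomega addSn.
  by rewrite !reward_pair// Emu Enu pmu_gt0 ltn0Sn lerD2l ler_piMl.
apply: le_trans (action_value_subset _ _ _ _ Vb Ve sS2) _.
(* M2 against M1 leads to the common state u, except for the packet that M1 has
   taken from nu. *)
apply: (action_value_le _ _ _ _ _ (c nu * (0 < p nu)%:R)) => //.
  move=> a; apply: le_trans (Ve _ (next_state p' S1 a)) _.
  rewrite lerD2l /excess_cost (sum_queues queuesE) !next_stateE !SE.
  rewrite Emu Enu Erho Eomega !subnDr !subn0 !subn1 /= !subnn !mulr0.
  by rewrite !addr0 add0r; case: (p nu) => [|k]; rewrite ?subSnn.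
rewrite !reward_pair// Emu Enu Erho Eomega !ltn0Sn !mulr1.
have : beta * (c nu * (0 < p nu)%:R) <= c nu * (0 < p nu)%:R.
  by rewrite ler_piMl// mulr_ge0.
by lra.
Qed.

Lemma full_matching_optimal (n : nat) (q : state) : q nu = 0%N ->
    (1 <= q mu)%N -> (1 <= q rho)%N -> (1 <= q omega)%N ->
  optimal_action A c beta n q (serve [set rho; omega]%SET).
Proof.
move=> q_nu q_mu q_rho q_omega.
have /and5P[mn _ _ _ /andP[_ ro]] := queues_neq queuesE.
have /and4P[_ _ Nmn Nro] := conflict_pattern queuesE mu_omega mu_rho.
have Vb := bounded_value n.
have Ve := excess_bounded_value n.
have SE := serve_matchingsE queuesE.
set S1 := serve [set mu; nu]%SET in SE *.
set S2 := serve [set rho; omega]%SET in SE *.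
have S2S : S2 \in schedules by exact: pair_schedule.
split; first exact: S2S.
apply/eqP; rewrite eq_le max_value_ge//=.
apply: max_value_le => s sS.
have [sS1|sS2] :=
  schedule_sub_matching queuesE mu_omega mu_rho s sS; last first.
  exact: action_value_subset.
apply: le_trans (action_value_subset _ _ _ _ Vb Ve sS1) _.
rewrite -[leRHS]addr0.
apply: (action_value_le _ _ _ _ _ (c rho + c omega - c mu)) => //.
  move=> a; apply: exchange_bounded_value; rewrite !next_stateE !SE ?subn0.
  - by rewrite !subn1 -addSn prednK.
  - by rewrite q_nu.
  - by rewrite !subn1 -addSn prednK.
  - by rewrite !subn1 -addSn prednK.
rewrite !reward_pair// q_nu q_mu q_rho q_omega ltnn !mulr1 mulr0 !addr0.
have : beta * (c rho + c omega - c mu) <= c rho + c omega - c mu.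
  by rewrite ler_piMl// subr_ge0.
by lra.
Qed.

End Exchange.
End Bellman.

Theorem theorem3 (d : measure_display) (T : measurableType d) (R : realType)
    (P : probability T R) (A : queue -> {RV P >-> nat})
    (A_indep : independent_coordinates A)
    (load_out : forall j : 'I_2, (\sum_(i < 2) mean A (i, j) < 1)%E)
    (load_in : forall i : 'I_2, (\sum_(j < 2) mean A (i, j) < 1)%E)
    (c : queue -> R) (c_ge0 : forall x, 0 <= c x)
    (beta : R) (beta_gt0 : 0 < beta) (beta_lt1 : beta < 1)
    (mu nu rho omega : queue)
    (queuesE : [set mu; nu; rho; omega]%SET = [set: queue]%SET)
    (mu_omega : conflict mu omega) (mu_rho : conflict mu rho)
    (c_lb : c mu <= c rho + c omega) (c_ub : c rho + c omega <= c mu + c nu)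
    (q : state) (q_nu : q nu = 0%N)
    (q_mu : (1 <= q mu)%N) (q_rho : (1 <= q rho)%N)
    (q_omega : (1 <= q omega)%N) :
  forall n : nat, optimal_action A c beta n q (serve [set rho; omega]%SET).
Proof.
move=> n.
by apply: (full_matching_optimal A c beta c_ge0 (ltW beta_gt0) (ltW beta_lt1)
  mu nu rho omega queuesE).
Qed.
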